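(* Let $\tau>0$. If $\gamma:I\to \mathrm{SL}(2,\mathbb{R})_\tau$ is a proper biharmonic curve parametrized by arc length, then its geodesic curvature $k_1$ and its geodesic torsion $k_2$ are constant.
   Context: Let $\mathbb{R}^4_2$ be $\mathbb{R}^4$ with the inner product $\langle v,w\rangle=v_1w_1+v_2w_2-v_3w_3-v_4w_4$; identify $\mathbb{R}^4$ with $\mathbb{C}^2$ via $(z,w)=(x_1+ix_2,x_3+ix_4)$, and identify $\mathrm{SL}(2,\mathbb{R})$ with $\{(z,w)\in\mathbb{C}^2: |z|^2-|w|^2=1\}=\{v\in\mathbb{R}^4_2:\langle v,v\rangle=1\}$. On it consider the tangent vector fields $$X_1(z,w)=(iz,iw),\quad X_2(z,w)=(i\bar w,i\bar z),\quad X_3(z,w)=(\bar w,\bar z).$$ For $\tau>0$, $\mathrm{SL}(2,\mathbb{R})_\tau$ denotes $\mathrm{SL}(2,\mathbb{R})$ with the Riemannian metric $g_\tau(X,Y)=-\langle X,Y\rangle+(1+\tau^2)\langle X,X_1\rangle\langle Y,X_1\rangle$. Then $E_1=-\tau^{-1}X_1$, $E_2=X_2$, $E_3=X_3$ is a global orthonormal frame, taken as positively oriented. Let $\nabla^\tau$ be the Levi-Civita connection of $g_\tau$ and $R(X,Y)Z=\nabla^\tau_X\nabla^\tau_YZ-\nabla^\tau_Y\nabla^\tau_XZ-\nabla^\tau_{[X,Y]}Z$ its curvature. Curves are smooth and defined on an open interval $I$. A curve $\gamma$ parametrized by arc length, with $T=\gamma'$, is biharmonic if its bitension field vanishes, i.e.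 $(\nabla^\tau_T)^3T-R(T,\nabla^\tau_TT)T=0$; it is proper biharmonic if it is biharmonic and not a geodesic. Frenet frame: $T=\gamma'$, $N$ is the unit vector field in the direction of $\nabla^\tau_TT$ (where the latter is non-zero), and $B$ is chosen so that $\{T,N,B\}$ is a positively oriented orthonormal basis. The geodesic curvature is $k_1=|\nabla^\tau_TT|$ and the geodesic torsion $k_2$ is defined by the Frenet equations $\nabla^\tau_TT=k_1N$, $\nabla^\tau_TN=-k_1T+k_2B$, $\nabla^\tau_TB=-k_2N$. *)

(* Defs.v *)
From HB Require Import structures.
From mathcomp Require Import all_boot all_order all_algebra.
From mathcomp Require Import all_classical all_reals all_analysis.

Set Implicit Arguments.
Unset Strict Implicit.
Unset Printing Implicit Defensive.

Import Order.TTheory GRing.Theory Num.Theory.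
Import numFieldNormedType.Exports.

Local Open Scope ring_scope.
Local Open Scope classical_set_scope.

Section SL2.
Context {R : realType}.

Notation vec := 'rV[R]_4.
Notation field_operator := ((vec -> vec) -> (vec -> vec) -> vec -> vec).

(* Coordinates are numbered from 0: (z, w) = (v 0 0 + i v 0 1, v 0 2 + i v 0 3) *)
Definition inner (v w : vec) : R :=
  v 0 0 * w 0 0 + v 0 1 * w 0 1 - v 0 2 * w 0 2 - v 0 3 * w 0 3.

Definition SL2 : set vec := [set p | inner p p = 1].

Definition tangent (p v : vec) : Prop := inner p v = 0.

(* (iz, iw) *)
Definition X1 (p : vec) : vec :=
  \row_(j < 4) [:: - p 0 1; p 0 0; - p 0 3; p 0 2]`_j.

(* (i \bar w, i \bar z) *)
Definition X2 (p : vec) : vec :=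
  \row_(j < 4) [:: p 0 3; p 0 2; p 0 1; p 0 0]`_j.

(* (\bar w, \bar z) *)
Definition X3 (p : vec) : vec :=
  \row_(j < 4) [:: p 0 2; - p 0 3; p 0 0; - p 0 1]`_j.

Definition gmetric (tau : R) (p v w : vec) : R :=
  - inner v w + (1 + tau ^+ 2) * (inner v (X1 p) * inner w (X1 p)).

(* E_1, E_2, E_3, numbered from 0 *)
Definition E (tau : R) (i : 'I_3) (p : vec) : vec :=
  [:: (- tau^-1) *: X1 p; X2 p; X3 p]`_i.

(* C^infinity on all of R^4: every iterated directional derivative exists and
   is Frechet differentiable *)
Definition smooth {W : normedModType R} (f : vec -> W) : Prop :=
  forall (vs : seq vec) (p : vec),
    differentiable (foldr (fun v h => 'D_v h : vec -> W) f vs) p.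

(* SL2 is closed in R^4, so its smooth functions and vector fields are the
   restrictions of smooth maps on R^4; only the values on SL2 matter. *)
Definition vector_field (X : vec -> vec) : Prop :=
  smooth X /\ forall p, SL2 p -> tangent p (X p).

Definition lie_bracket (X Y : vec -> vec) (p : vec) : vec :=
  'D_(X p) Y p - 'D_(Y p) X p.

Record is_connection (nabla : field_operator) : Prop := {
  conn_field : forall X Y, vector_field X -> vector_field Y ->
    vector_field (nabla X Y);
  (* nabla acts on fields on SL2, not on their extensions to R^4 *)
  conn_ext : forall X X' Y Y', vector_field X -> vector_field X' ->
    vector_field Y -> vector_field Y' ->
    {in SL2, X =1 X'} -> {in SL2, Y =1 Y'} ->
    {in SL2, nabla X Y =1 nabla X' Y'};
  conn_addl : forall X X' Y p, vector_field X -> vector_field X' ->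
    vector_field Y -> SL2 p ->
    nabla (fun q => X q + X' q) Y p = nabla X Y p + nabla X' Y p;
  conn_scalel : forall (f : vec -> R) X Y p, smooth f -> vector_field X ->
    vector_field Y -> SL2 p ->
    nabla (fun q => f q *: X q) Y p = f p *: nabla X Y p;
  conn_addr : forall X Y Y' p, vector_field X -> vector_field Y ->
    vector_field Y' -> SL2 p ->
    nabla X (fun q => Y q + Y' q) p = nabla X Y p + nabla X Y' p;
  conn_leibniz : forall (f : vec -> R) X Y p, smooth f -> vector_field X ->
    vector_field Y -> SL2 p ->
    nabla X (fun q => f q *: Y q) p = 'D_(X p) f p *: Y p + f p *: nabla X Y p
}.

Record is_levi_civita (tau : R) (nabla : field_operator) : Prop := {
  lc_connection : is_connection nabla;
  lc_torsion_free : forall X Y p, vector_field X -> vector_field Y -> SL2 p ->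
    nabla X Y p - nabla Y X p = lie_bracket X Y p;
  lc_metric : forall X Y Z p, vector_field X -> vector_field Y ->
    vector_field Z -> SL2 p ->
    'D_(X p) (fun q => gmetric tau q (Y q) (Z q)) p =
    gmetric tau p (nabla X Y p) (Z p) + gmetric tau p (Y p) (nabla X Z p)
}.

Definition curvature (nabla : field_operator)
    (X Y Z : vec -> vec) (p : vec) : vec :=
  nabla X (nabla Y Z) p - nabla Y (nabla X Z) p - nabla (lie_bracket X Y) Z p.

(* the field with constant coefficients in the frame E taking the value u at p *)
Definition frame_extension (tau : R) (p u : vec) (q : vec) : vec :=
  \sum_(i < 3) gmetric tau p u (E tau i p) *: E tau i q.

(* The curvature is a tensor: R(u, v)w may be computed with any fields extending
   the tangent vectors u, v, w at p *)
Definition curvature_at (tau : R) (nabla : field_operator)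
    (p u v w : vec) : vec :=
  curvature nabla (frame_extension tau p u) (frame_extension tau p v)
    (frame_extension tau p w) p.

(* nabla_u E_j at p, for a tangent vector u at p *)
Definition nabla_frame (tau : R) (nabla : field_operator)
    (p u : vec) (j : 'I_3) : vec :=
  \sum_(i < 3) gmetric tau p u (E tau i p) *: nabla (E tau i) (E tau j) p.

(* covariant derivative along gamma of V = \sum_j v_j E_j, that is
   nabla_T V = \sum_j (v_j' E_j + v_j nabla_T E_j), with T = gamma' *)
Definition covariant_derivative (tau : R)
    (nabla : field_operator)
    (gamma V : R -> vec) (t : R) : vec :=
  \sum_(j < 3)
    (derive1 (fun s => gmetric tau (gamma s) (V s) (E tau j (gamma s))) t
       *: E tau j (gamma t) +
     gmetric tau (gamma t) (V t) (E tau j (gamma t))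
       *: nabla_frame tau nabla (gamma t) (derive1 gamma t) j).

Definition smooth_curve (I : set R) (gamma : R -> vec) : Prop :=
  (forall n t, I t -> derivable (derive1n n gamma) t 1) /\
  (forall t, I t -> SL2 (gamma t)).

Definition arc_length_param (tau : R) (I : set R) (gamma : R -> vec) : Prop :=
  forall t, I t -> gmetric tau (gamma t) (derive1 gamma t) (derive1 gamma t) = 1.

Definition acceleration (tau : R)
    (nabla : field_operator) (gamma : R -> vec) : R -> vec :=
  covariant_derivative tau nabla gamma (derive1 gamma).

Definition biharmonic (tau : R)
    (nabla : field_operator)
    (I : set R) (gamma : R -> vec) : Prop :=
  forall t, I t ->
    iter 3 (covariant_derivative tau nabla gamma) (derive1 gamma) t -
    curvature_at tau nabla (gamma t) (derive1 gamma t)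
      (acceleration tau nabla gamma t) (derive1 gamma t) = 0.

Definition geodesic (tau : R)
    (nabla : field_operator)
    (I : set R) (gamma : R -> vec) : Prop :=
  forall t, I t -> acceleration tau nabla gamma t = 0.

Definition proper_biharmonic (tau : R)
    (nabla : field_operator)
    (I : set R) (gamma : R -> vec) : Prop :=
  biharmonic tau nabla I gamma /\ ~ geodesic tau nabla I gamma.

(* (u, v, w) is an orthonormal basis of the tangent space at p with the
   orientation of (E_1, E_2, E_3) *)
Definition positive_orthonormal (tau : R) (p u v w : vec) : Prop :=
  let e (i : 'I_3) : vec := [:: u; v; w]`_i in
  [/\ forall i, tangent p (e i),
      forall i j, gmetric tau p (e i) (e j) = (i == j)%:R &
      0 < \det (\matrix_(i < 3, j < 3) gmetric tau p (e i) (E tau j p))].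

(* N, B and k2 are only constrained at the points where the acceleration does
   not vanish *)
Definition frenet_apparatus (tau : R)
    (nabla : field_operator)
    (I : set R) (gamma N B : R -> vec) (k1 k2 : R -> R) : Prop :=
  let T := derive1 gamma in
  let DT := covariant_derivative tau nabla gamma in
  forall t, I t ->
    k1 t = Num.sqrt (gmetric tau (gamma t) (DT T t) (DT T t)) /\
    (DT T t <> 0 ->
     [/\ positive_orthonormal tau (gamma t) (T t) (N t) (B t),
         DT T t = k1 t *: N t,
         DT N t = - k1 t *: T t + k2 t *: B t &
         DT B t = - k2 t *: N t]).

End SL2.

(* Main.v *)
Require Import Defs.
From HB Require Import structures.
From mathcomp Require Import all_boot all_order all_algebra.
From mathcomp Require Import all_classical all_reals all_analysis.
From mathcomp Require Import ring lra.
Set Implicit Arguments.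
Unset Strict Implicit.
Unset Printing Implicit Defensive.
Import Order.TTheory GRing.Theory Num.Theory.
Import numFieldNormedType.Exports.
Local Open Scope ring_scope.
Local Open Scope classical_set_scope.

(** The left-invariant frame [E] trivialises the tangent bundle, and in this
    frame everything has constant coefficients.  A field along a curve becomes a
    function into R^3, the covariant derivative along the curve becomes
    [v' + (Omega T) x v] with [Omega = diag(- tau - 2 / tau, tau, tau)]
    ([nabla_frame_field], from Koszul's formula), and the curvature becomes
    [R(u, v) w = (K (u x v)) x w] with
    [K = diag(3 tau^2 + 4, - tau^2, - tau^2)] ([curvature_frame_field]).  Both
    matrices are multiples of the identity up to a term along the first axis;
    the argument rests on this axial symmetry.

    Write [A = D T], [D = D A] for the successive covariant derivatives of
    the velocity [T], put [f = <A, A>], [b = T x A] and [q = <b, D>].  For a curve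
    of constant curvature [f > 0] one has [k1 = sqrt f] and [k2 = q / f], so it
    suffices to show that [f] and [q] are constant; working with [A] and [q] rather
    than with the normalised Frenet frame avoids any division before [f > 0] is
    known.

    The component of the biharmonic equation along [T] gives [f' = 0] on the whole
    interval ([curvature_const]); a curve that is not a geodesic therefore has no
    point at which its acceleration vanishes.  Let [K2 = - tau^2] be the double
    eigenvalue of [K] and [k = 4 (tau^2 + 1)] the difference with the simple one;
    the subscript 1 denotes first components.  The component along [b] gives
    [q' = - k b_1 A_1] ([torsion_derive]), and the component along [A] gives the
    relation [q^2 + f^2 K2 + f k b_1^2 + f^3 = 0]
    ([torsion_first_integral]).  By the axial symmetry
    [b_1' = (tau - q / f) A_1], so differentiating the relation yields
    [q' (tau f - 2 q) = 0] ([torsion_critical]).  Hence [(tau f - 2 q)^2] is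
    constant: if it is zero, [q = tau f / 2]; otherwise [q' = 0] everywhere. *)

(** * Real functions on an interval *)

Section RealCalculus.
Context {R : realType}.

Lemma is_derive_add (f g : R -> R) (t a b : R) :
  is_derive t 1 f a -> is_derive t 1 g b ->
  is_derive t 1 (fun s => f s + g s) (a + b).
Proof. exact: is_deriveD. Qed.

Lemma is_derive_opp (f : R -> R) (t a : R) :
  is_derive t 1 f a -> is_derive t 1 (fun s => - f s) (- a).
Proof. exact: is_deriveN. Qed.

Lemma is_derive_mul (f g : R -> R) (t a b : R) :
  is_derive t 1 f a -> is_derive t 1 g b ->
  is_derive t 1 (fun s => f s * g s) (f t * b + g t * a).
Proof. exact: is_deriveM. Qed.

Lemma is_derive_const (c t : R) : is_derive t 1 (fun _ : R => c) 0.
Proof. exact: is_derive_cst. Qed.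

Lemma is_derive_unique (f : R -> R) (t a b : R) :
  is_derive t 1 f a -> is_derive t 1 f b -> a = b.
Proof. by case=> _ <- [_ <-]. Qed.

Lemma is_derive_open (I : set R) (f g : R -> R) (t a : R) : open I -> I t ->
  (forall s, I s -> f s = g s) -> is_derive t 1 f a -> is_derive t 1 g a.
Proof.
move=> Io It fg; apply: near_eq_is_derive.
near=> s; apply: fg; near: s; exact: open_nbhs_nbhs.
Unshelve. all: end_near. Qed.

Lemma derive_locally_const (I : set R) (f : R -> R) (c t a : R) :
  open I -> I t -> (forall s, I s -> f s = c) -> is_derive t 1 f a -> a = 0.
Proof.
move=> Io It fc fa.
exact: is_derive_unique (is_derive_open Io It fc fa) (is_derive_const c t).
Qed.

Lemma derive0_const (I : set R) (f : R -> R) : is_interval I ->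
  (forall t, I t -> is_derive t 1 f 0) ->
  exists c, forall t, I t -> f t = c.
Proof.
move=> Ii f0.
have lt_eq x y : I x -> I y -> x < y -> f x = f y.
  move=> Ix Iy xy.
  have Ixy z : z \in `[x, y]%R -> I z by rewrite in_itv; exact: Ii.
  have [||c _] := @MVT R f (fun=> 0) x y xy.
  - by move=> z /subset_itv_oo_cc /Ixy; exact: f0.
  - by apply: derivable_within_continuous => z /Ixy /f0 [].
  - by rewrite mul0r => /eqP; rewrite subr_eq0 => /eqP.
have [[a Ia]|I0] := pselect (exists a, I a); last first.
  by exists 0 => t It; case: I0; exists t.
exists (f a) => t It; have [ta|at_|<-//] := ltgtP t a.
- exact: lt_eq.
- by rewrite (lt_eq a t).
Qed.

End RealCalculus.

(** * Vector algebra in dimension three *)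

Section Vec3.
Context {R : realType}.
Implicit Types u v w : 'I_3 -> R.

Definition dot u v : R := u 0 * v 0 + u 1 * v 1 + u 2 * v 2.

Definition cross u v (i : 'I_3) : R :=
  [:: u 1 * v 2 - u 2 * v 1; u 2 * v 0 - u 0 * v 2; u 0 * v 1 - u 1 * v 0]`_i.

Definition axial (a b : R) u (i : 'I_3) : R := [:: a * u 0; b * u 1; b * u 2]`_i.

Lemma crossE u v : ((cross u v 0 = u 1 * v 2 - u 2 * v 1) *
  (cross u v 1 = u 2 * v 0 - u 0 * v 2) *
  (cross u v 2 = u 0 * v 1 - u 1 * v 0))%type.
Proof. by []. Qed.

Lemma axialE a b u : ((axial a b u 0 = (a * u 0)%R) *
  (axial a b u 1 = (b * u 1)%R) * (axial a b u 2 = (b * u 2)%R))%type.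
Proof. by []. Qed.

Lemma ord3_ind (P : 'I_3 -> Prop) : P 0 -> P 1 -> P 2 -> forall i, P i.
Proof.
by move=> P0 P1 P2 [[|[|[|//]]] i3]; [move: P0|move: P1|move: P2];
  congr P; exact: val_inj.
Qed.

Lemma dot_ge0 u : dot u u >= 0.
Proof. by rewrite /dot -!expr2; do ?apply: addr_ge0; exact: sqr_ge0. Qed.

Lemma dot_eq0 u : dot u u = 0 -> forall i, u i = 0.
Proof.
rewrite /dot => u0; have [h0 h1 h2] :
  [/\ 0 <= u 0 * u 0, 0 <= u 1 * u 1 & 0 <= u 2 * u 2].
  by rewrite -!expr2; split; exact: sqr_ge0.
by elim/ord3_ind; apply/eqP; rewrite -sqrf_eq0 expr2; apply/eqP; lra.
Qed.

(** The square of a triple product is the Gram determinant. *)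
Lemma gram3 u v w : dot (cross u v) w ^+ 2 =
  dot u u * (dot v v * dot w w - dot v w ^+ 2)
  - dot u v * (dot u v * dot w w - dot v w * dot u w)
  + dot u w * (dot u v * dot v w - dot v v * dot u w).
Proof. rewrite /dot !crossE; ring. Qed.

End Vec3.

Section OrientedBasis.
Context {R : realType}.
Implicit Types u v w : 'I_3 -> R.

Lemma det3_dot_cross (M : 'M[R]_3) : \det M = dot (cross (M 0) (M 1)) (M 2).
Proof.
pose F (i j : nat) := M (inord i) (inord j).
have ME i j : M i j = F i j by rewrite /F !inord_val.
rewrite (expand_det_row _ ord0) !big_ord_recl big_ord0 /cofactor.
rewrite !(expand_det_row _ ord0) !big_ord_recl !big_ord0 /cofactor !det_mx11 !mxE.
rewrite /dot !crossE !ME /bump /= !exprS !expr0; ring.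
Qed.

(** The Gram determinant gives [<u x v, w>^2 = 1] and the orientation fixes the
    sign, so that the squared norm of [w - u x v] is [1 - 2 + 1 = 0]. *)
Lemma oriented_orthonormal_cross u v w :
  dot u u = 1 -> dot v v = 1 -> dot w w = 1 ->
  dot u v = 0 -> dot u w = 0 -> dot v w = 0 ->
  0 < dot (cross u v) w -> forall i, w i = cross u v i.
Proof.
move=> uu vv ww uv uw vw det_gt0 i.
have det1 : dot (cross u v) w = 1.
  have := gram3 u v w; rewrite uu vv ww uv uw vw => det2.
  have : dot (cross u v) w ^+ 2 == 1 by rewrite det2; apply/eqP; ring.
  rewrite sqrf_eq1 => /orP[/eqP//|/eqP e]; move: det_gt0; rewrite e; lra.
apply/eqP; rewrite -subr_eq0; apply/eqP; move: i.
apply: (@dot_eq0 _ (fun i => w i - cross u v i)).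
transitivity (dot w w - 2 * dot (cross u v) w + (dot u u * dot v v - dot u v ^+ 2)).
  by rewrite /dot !crossE; ring.
by rewrite det1 uu vv ww uv; ring.
Qed.

End OrientedBasis.

(** * Covariant derivatives in an orthonormal frame *)

Section MovingFrame.
Context {R : realType} (I : set R) (omega : R -> 'I_3 -> R).
Implicit Types u v : R -> 'I_3 -> R.

(** In an orthonormal frame along a curve, a metric connection differs from the
    componentwise derivative by a skew matrix, that is by the cross product with
    some [omega], the angular velocity of the frame. *)
Definition has_cov_deriv u Du : Prop := forall t, I t -> forall i,
  is_derive t 1 (fun s => u s i) (Du t i - cross (omega t) (u t) i).

Lemma covariant_dot u Du v Dv t : has_cov_deriv u Du -> has_cov_deriv v Dv -> I t ->
  is_derive t 1 (fun s => dot (u s) (v s)) (dot (Du t) (v t) + dot (u t) (Dv t)).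
Proof.
move=> hu hv It; rewrite /dot; apply: is_derive_eq.
  by do ?apply: is_derive_add; apply: is_derive_mul; by [exact: hu|exact: hv].
rewrite !crossE; ring.
Qed.

Lemma covariant_cross u Du v Dv : has_cov_deriv u Du -> has_cov_deriv v Dv ->
  has_cov_deriv (fun t => cross (u t) (v t))
            (fun t i => cross (Du t) (v t) i + cross (u t) (Dv t) i).
Proof.
move=> hu hv t It; elim/ord3_ind.
all: apply: is_derive_eq; first (apply: is_derive_add; [|apply: is_derive_opp];
  apply: is_derive_mul; by [exact: hu|exact: hv]).
all: rewrite !crossE; ring.
Qed.

End MovingFrame.

(** * The biharmonic equation as a differential system *)

Section BiharmonicODE.
Context {R : realType} (I : set R) (Iopen : open I) (Iitv : is_interval I).
Context (mu tau K1 K2 : R) (T A D D3 : R -> 'I_3 -> R).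
Let omega t := axial mu tau (T t).
Context (covT : has_cov_deriv I omega T A) (covA : has_cov_deriv I omega A D).
Context (covD : has_cov_deriv I omega D D3).
Context (biharm : forall t, I t -> forall i,
  D3 t i = cross (axial K1 K2 (cross (T t) (A t))) (T t) i).
Context (unit_speed : forall t, I t -> dot (T t) (T t) = 1).

Lemma dotTA t : I t -> dot (T t) (A t) = 0.
Proof.
move=> It.
have := derive_locally_const Iopen It unit_speed (covariant_dot covT covT It).
rewrite /dot; lra.
Qed.

Lemma dotTD t : I t -> dot (T t) (D t) = - dot (A t) (A t).
Proof.
move=> It; have := derive_locally_const Iopen It dotTA (covariant_dot covT covA It).
lra.
Qed.

(** The equation makes [D3] orthogonal to [T]; so the derivative of
    [<T, D> + <A, A> = 0] is [3 <A, D> = 0]. *)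
Lemma dotAD t : I t -> dot (A t) (D t) = 0.
Proof.
move=> It.
have h s : I s -> dot (T s) (D s) + dot (A s) (A s) = 0.
  by move/dotTD => ->; rewrite addNr.
have := derive_locally_const Iopen It h
  (is_derive_add (covariant_dot covT covD It) (covariant_dot covA covA It)).
have -> : dot (T t) (D3 t) = 0.
  by rewrite /dot !biharm // !crossE; ring.
rewrite /dot; lra.
Qed.

Lemma curvature_const : exists f, forall t, I t -> dot (A t) (A t) = f.
Proof.
apply: (derive0_const Iitv) => t It.
apply: (is_derive_eq (covariant_dot covA covA It)).
have := dotAD It; rewrite /dot; lra.
Qed.

Context (f : R) (f_gt0 : 0 < f) (dotAA : forall t, I t -> dot (A t) (A t) = f).
Let b t := cross (T t) (A t).
Let q t := dot (b t) (D t).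
Let dq t := - (K1 - K2) * b t 0 * A t 0.

Lemma dotDA t : I t -> dot (D3 t) (A t) = - dot (D t) (D t).
Proof.
move=> It; have := derive_locally_const Iopen It dotAD (covariant_dot covA covD It).
rewrite /dot; lra.
Qed.

Lemma crossTb t i : I t -> cross (T t) (b t) i = - A t i.
Proof.
move=> It; have h1 := unit_speed It; have h2 := dotTA It.
transitivity (dot (T t) (A t) * T t i - dot (T t) (T t) * A t i); last first.
  by rewrite h1 h2; ring.
by elim/ord3_ind: i; rewrite /b /dot !crossE; ring.
Qed.

Lemma dot_bb t : I t -> dot (b t) (b t) = f.
Proof.
move=> It.
transitivity (dot (T t) (T t) * dot (A t) (A t) - dot (T t) (A t) ^+ 2).
  by rewrite /b /dot !crossE; ring.
by rewrite unit_speed // dotAA // dotTA //; ring.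
Qed.

(** Only [D3] survives in [<b, D>'], because [b' = T x D] is orthogonal to [D].
    Then [<b, (K b) x T> = <K b, T x b> = - <K b, A>], in which the isotropic
    part of [K] drops out since [b] is orthogonal to [A]. *)
Lemma torsion_derive t : I t -> is_derive t 1 q (dq t).
Proof.
move=> It; apply: is_derive_eq.
  exact: (covariant_dot (covariant_cross covT covA) covD It).
have -> : dq t = dot (axial K1 K2 (b t)) (cross (T t) (b t)).
  have bA : dot (b t) (A t) = 0 by rewrite /dot /b !crossE; ring.
  transitivity (dq t - K2 * dot (b t) (A t)); first by rewrite bA mulr0 subr0.
  by rewrite /dot !crossTb // !axialE /dq; ring.
rewrite /dot !biharm // /b !crossE !axialE !crossE.
ring.
Qed.

(** The Gram determinant of [(T, A, D)] expresses [q^2] through [<D, D>], and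
    [<D, D> = - <D3, A>] is given by the component of the equation along [A]. *)
Lemma torsion_first_integral t : I t ->
  q t ^+ 2 + f ^+ 2 * K2 + f * (K1 - K2) * (b t 0 * b t 0) + f ^+ 3 = 0.
Proof.
move=> It.
have -> : q t ^+ 2 = f * dot (D t) (D t) - f ^+ 3.
  rewrite /q /b gram3 unit_speed // dotTA // dotAA // dotAD // dotTD // dotAA //.
  by ring.
have -> : dot (D t) (D t) = - dot (D3 t) (A t) by rewrite dotDA // opprK.
have -> : dot (D3 t) (A t) = K2 * f + (K1 - K2) * (b t 0 * b t 0).
  rewrite -(dot_bb It) /dot !biharm // /b !crossE !axialE !crossE; ring.
ring.
Qed.

(** [T x D] is a multiple of [A] because [D] lies in the span of [T] and [b].
    The proof computes the norm of the difference. *)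
Lemma crossTD t i : I t -> f * cross (T t) (D t) i = - q t * A t i.
Proof.
move=> It; apply/eqP; rewrite -subr_eq0; apply/eqP; move: i.
apply: (@dot_eq0 _ (fun i => f * cross (T t) (D t) i - - q t * A t i)).
transitivity (f ^+ 2 * (dot (T t) (T t) * dot (D t) (D t) - dot (T t) (D t) ^+ 2)
   - 2 * f * q t ^+ 2 + q t ^+ 2 * dot (A t) (A t)).
  by rewrite /q /b /dot !crossE; ring.
rewrite {1 2}/q /b gram3 unit_speed // dotTA // dotTD // dotAD // dotAA //; ring.
Qed.

(** The first component of [omega x b] is [tau (T x b)_1 = - tau A_1]: the
    coefficients of [omega] on the two last axes are equal. *)
Lemma b0_derive t : I t -> is_derive t 1 (fun s => b s 0) ((tau - q t / f) * A t 0).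
Proof.
move=> It; apply: is_derive_eq; first exact: (covariant_cross covT covA It).
have h1 := crossTD 0 It; have h2 := crossTb 0 It.
have -> : cross (T t) (D t) 0 = - q t / f * A t 0.
  apply: (mulfI (lt0r_neq0 f_gt0)); rewrite h1; field; exact: lt0r_neq0.
have -> : cross (omega t) (cross (T t) (A t)) 0 = tau * cross (T t) (b t) 0.
  by rewrite /b /omega !crossE !axialE; ring.
rewrite h2 !crossE; ring.
Qed.

(** By [b0_derive], the derivative of [torsion_first_integral] is
    [2 q q' - 2 q' (tau f - q) = - 2 q' (tau f - 2 q)], whence the factor [-2]
    in the proof. *)
Lemma torsion_critical t : I t -> dq t * (tau * f - 2 * q t) = 0.
Proof.
move=> It; have bD := b0_derive It; have qD := torsion_derive It.
have h s : I s -> q s * q s + f * (K1 - K2) * (b s 0 * b s 0)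
   = - f ^+ 2 * K2 - f ^+ 3.
  move=> /torsion_first_integral; rewrite expr2; lra.
have dh := derive_locally_const Iopen It h (is_derive_add (is_derive_mul qD qD)
  (is_derive_mul (is_derive_const (f * (K1 - K2)) t) (is_derive_mul bD bD))).
have two0 : (-2 : R) != 0 by rewrite oppr_eq0 pnatr_eq0.
apply: (mulfI two0); rewrite mulr0 -[RHS]dh /dq; field; exact: lt0r_neq0.
Qed.

Lemma torsion_const : exists c, forall t, I t -> q t = c.
Proof.
pose l s := tau * f - 2 * q s.
have lD t : I t -> is_derive t 1 l (- (2 * dq t)).
  move=> It; have h := is_derive_add (is_derive_const (tau * f) t)
    (is_derive_opp (is_derive_mul (is_derive_const 2 t) (torsion_derive It))).
  by apply: (is_derive_eq h); ring.
have [c hc] : exists c, forall t, I t -> l t * l t = c.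
  apply: (derive0_const Iitv) => t It.
  apply: (is_derive_eq (is_derive_mul (lD t It) (lD t It))).
  have := torsion_critical It; rewrite /l; lra.
have [c0|c0] := eqVneq c 0.
  exists (tau * f / 2) => t /hc /eqP; rewrite c0 mulf_eq0 orbb /l => /eqP; lra.
apply: (derive0_const Iitv) => t It.
suff <- : dq t = 0 by exact: torsion_derive.
have /eqP := torsion_critical It; rewrite mulf_eq0 => /orP[/eqP//|/eqP l0].
by move: c0; rewrite -(hc t It) /l l0 mul0r eqxx.
Qed.

End BiharmonicODE.

(** * Linear vector fields *)

Section LinearFields.
Context {R : realType}.
Notation vec := 'rV[R]_4.

Lemma linear_fun_differentiable (f : vec -> vec) (p : vec) :
  linear f -> differentiable f p.
Proof.
move=> lf.
pose F : {linear vec -> vec} := HB.pack f (GRing.isLinear.Build R vec vec _ f lf).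
have -> : f = \sum_(i < 4) (fun q : vec => q 0 i *: f (delta_mx 0 i)).
  apply/funext => q; rewrite fct_sumE {1}[q]row_sum_delta.
  rewrite -[f]/(F : vec -> vec) linear_sum.
  by apply: eq_bigr => i _; rewrite linearZ.
apply: differentiable_sum => i; apply: differentiableZl.
exact: differentiable_coord.
Qed.

Lemma linear_fun_derive (f : vec -> vec) (p v : vec) : linear f -> 'D_v f p = f v.
Proof.
move=> lf.
pose F : {linear vec -> vec} := HB.pack f (GRing.isLinear.Build R vec vec _ f lf).
have cf : continuous F.
  by move=> q; apply: differentiable_continuous; exact: linear_fun_differentiable.
rewrite deriveE; last exact: linear_fun_differentiable.
by rewrite -[f]/(F : vec -> vec) diff_lin.
Qed.

(** The first derivative of a linear map in a fixed direction is constant, and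
    the later ones vanish. *)
Lemma linear_fun_smooth (f : vec -> vec) : linear f -> smooth f.
Proof.
move=> lf [|v vs] p; first exact: linear_fun_differentiable.
suff [c ->] : exists c, foldr (fun v h => 'D_v h : vec -> vec) f (v :: vs) = cst c.
  exact: differentiable_cst.
elim: vs v => [|w vs ih] v /=.
  by exists (f v); apply/funext => q; rewrite linear_fun_derive.
have [c /= ->] := ih w; exists 0; apply/funext => q; exact: derive_cst.
Qed.

Lemma is_derive_coord (p v : vec) (i : 'I_4) :
  is_derive p v (fun q : vec => q 0 i) (v 0 i).
Proof.
have h : derivable (id : vec -> vec) p v by [].
apply: DeriveDef; first by have /derivable_mxP := h; exact.
have := derive_mx h; rewrite derive_id => /matrixP /(_ 0 i); by rewrite mxE.
Qed.

End LinearFields.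

(** * The left-invariant frame *)

Section Frame.
Context {R : realType} (tau : R) (tau0 : tau != 0).
Notation vec := 'rV[R]_4.
Implicit Types (p q v : vec) (c d e : 'I_3 -> R).

(** The fields with constant coefficients in the frame are stable under all the
    operations below: Lie bracket, connection and curvature. *)
Definition frame_field c p : vec := \sum_(i < 3) c i *: E tau i p.

Definition frame_coord p v (i : 'I_3) : R := gmetric tau p v (E tau i p).

Lemma rV4P (u v : vec) :
  u 0 0 = v 0 0 -> u 0 1 = v 0 1 -> u 0 2 = v 0 2 -> u 0 3 = v 0 3 -> u = v.
Proof.
move=> h0 h1 h2 h3; apply/rowP => -[[|[|[|[|//]]]] i4];
  [move: h0|move: h1|move: h2|move: h3]; congr (u 0 _ = v 0 _); exact: val_inj.
Qed.

Lemma sum3E (V : zmodType) (F : 'I_3 -> V) : \sum_(i < 3) F i = F 0 + F 1 + F 2.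
Proof.
rewrite !big_ord_recr big_ord0 /= add0r; congr (F _ + F _ + F _); exact: val_inj.
Qed.

Lemma frame_fieldE c p :
  ((frame_field c p 0 0 = (tau^-1 * c 0 * p 0 1 + c 1 * p 0 3 + c 2 * p 0 2)%R) *
   (frame_field c p 0 1 = (- tau^-1 * c 0 * p 0 0 + c 1 * p 0 2 - c 2 * p 0 3)%R) *
   (frame_field c p 0 2 = (tau^-1 * c 0 * p 0 3 + c 1 * p 0 1 + c 2 * p 0 0)%R) *
   (frame_field c p 0 3 =
      (- tau^-1 * c 0 * p 0 2 + c 1 * p 0 0 - c 2 * p 0 1)%R))%type.
Proof. by rewrite /frame_field sum3E /E /=; do !split; rewrite !mxE /=; ring. Qed.

Lemma frame_field_linear c : linear (frame_field c).
Proof. by move=> a u v; apply: rV4P; rewrite 2!mxE !frame_fieldE !mxE; ring. Qed.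

Lemma frame_fieldN c p : frame_field (fun i => - c i) p = - frame_field c p.
Proof. by rewrite /frame_field -sumrN; apply: eq_bigr => i _; rewrite scaleNr. Qed.

Lemma frame_fieldD c d p :
  frame_field (fun i => c i + d i) p = frame_field c p + frame_field d p.
Proof.
by rewrite /frame_field -big_split; apply: eq_bigr => i _; rewrite scalerDl.
Qed.

Lemma frame_fieldZ (a : R) c p :
  frame_field (fun i => a * c i) p = a *: frame_field c p.
Proof.
by rewrite /frame_field scaler_sumr; apply: eq_bigr => i _; rewrite scalerA.
Qed.

Lemma E_frame_field (j : 'I_3) : E tau j = frame_field (fun i => (i == j)%:R).
Proof.
apply/funext => p; rewrite /frame_field (bigD1 j) //= eqxx scale1r big1 ?addr0 //.
by move=> i /negPf ->; rewrite scale0r.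
Qed.

Lemma X1E p : ((X1 p 0 0 = (- p 0 1)%R) * (X1 p 0 1 = p 0 0) *
  (X1 p 0 2 = (- p 0 3)%R) * (X1 p 0 3 = p 0 2))%type.
Proof. by rewrite !mxE. Qed.

Lemma frame_field_tangent c p : tangent p (frame_field c p).
Proof. by rewrite /tangent /inner !frame_fieldE; ring. Qed.

Lemma frame_field_vector_field c : vector_field (frame_field c).
Proof.
split; [exact/linear_fun_smooth/frame_field_linear|].
by move=> p _; exact: frame_field_tangent.
Qed.

Lemma gmetric_frame_field c d p : gmetric tau p (frame_field c p) (frame_field d p) =
  tau ^- 2 * (- inner p p + (1 + tau ^+ 2) * (inner p p * inner p p)) * (c 0 * d 0)
  + inner p p * (c 1 * d 1 + c 2 * d 2).
Proof. rewrite /gmetric /inner !X1E !frame_fieldE; field; exact: tau0. Qed.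

Lemma gmetric_frame_field_SL2 c d p : SL2 p ->
  gmetric tau p (frame_field c p) (frame_field d p) = dot c d.
Proof. by rewrite gmetric_frame_field /SL2 /= => ->; rewrite /dot; field. Qed.

Lemma frame_coordK c p : SL2 p -> frame_coord p (frame_field c p) =1 c.
Proof.
move=> Sp i; rewrite /frame_coord E_frame_field gmetric_frame_field_SL2 //.
by elim/ord3_ind: i; rewrite /dot /= ?mulr1 ?mulr0; ring.
Qed.

Lemma frame_coordE p v : SL2 p ->
  ((frame_coord p v 0 = (- tau * inner v (X1 p))%R) *
   (frame_coord p v 1 = (- inner v (X2 p))%R) *
   (frame_coord p v 2 = (- inner v (X3 p))%R))%type.
Proof.
rewrite /SL2 /= => Sp.
have h1 : inner (X1 p) (X1 p) = 1.
  by rewrite -[RHS]Sp /inner !X1E; ring.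
have h2 : inner (X2 p) (X1 p) = 0 by rewrite /inner !mxE /=; ring.
have h3 : inner (X3 p) (X1 p) = 0 by rewrite /inner !mxE /=; ring.
have hZ a u w : inner u (a *: w) = a * inner u w by rewrite /inner !mxE; ring.
have hZ' a u w : inner (a *: u) w = a * inner u w by rewrite /inner !mxE; ring.
rewrite /frame_coord /gmetric /E /= hZ hZ' h1 h2 h3; split; [split|]; try ring.
by field.
Qed.

(** The vectors [p], [X1 p], [X2 p], [X3 p] are orthogonal for the form [inner],
    of squares [1], [1], [-1], [-1]: a vector is the sum of its components along
    them, and the one along [p] vanishes for a tangent vector. *)
Lemma frame_fieldK p v : SL2 p -> tangent p v -> frame_field (frame_coord p v) p = v.
Proof.
move=> Sp pv.
have vE k : v 0 k = inner p p * v 0 k - inner p v * p 0 k.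
  by rewrite (Sp : inner p p = 1) (pv : inner p v = 0); ring.
apply: rV4P; rewrite [RHS]vE !frame_fieldE !frame_coordE // /inner !mxE /=.
all: by field.
Qed.

Lemma gmetric_dot p u v : SL2 p -> tangent p u -> tangent p v ->
  gmetric tau p u v = dot (frame_coord p u) (frame_coord p v).
Proof.
move=> Sp hu hv; rewrite -[in LHS](frame_fieldK Sp hu) -[in LHS](frame_fieldK Sp hv).
exact: gmetric_frame_field_SL2.
Qed.

(** The bracket is [[E_1, E_2] = - (2 / tau) E_3], [[E_2, E_3] = 2 tau E_1],
    [[E_3, E_1] = - (2 / tau) E_2]. *)
Definition structure_const c d :=
  axial (2 * tau) (- (2 / tau)) (cross c d).

(** The vector [Omega u] for which [nabla_u E_j = (Omega u) x E_j].  Its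
    coefficient on an axis is half the sum of the three structure constants,
    minus the one of that axis. *)
Definition connection_vec := axial (- tau - 2 / tau) tau.

Lemma lie_bracket_frame_field c d :
  lie_bracket (frame_field c) (frame_field d) = frame_field (structure_const c d).
Proof.
apply/funext => p.
rewrite /lie_bracket !linear_fun_derive; try exact: frame_field_linear.
apply: rV4P; rewrite 2!mxE !frame_fieldE /structure_const !axialE !crossE.
all: by field.
Qed.

Lemma inner_derive p v : is_derive p v (fun q => inner q q) (2 * inner p v).
Proof.
have c i := is_derive_coord p v i.
pose m i := is_deriveM (c i) (c i).
have h := is_deriveB (is_deriveB (is_deriveD (m 0) (m 1)) (m 2)) (m 3).
apply: (is_derive_eq h); rewrite /inner /GRing.scale /=; ring.
Qed.

(** On the whole of R^4 the inner products of the frame are polynomials in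
    [inner q q], whose derivative vanishes in the tangent directions. *)
Lemma gmetric_frame_field_derive c d p v : tangent p v ->
  'D_v (fun q => gmetric tau q (frame_field c q) (frame_field d q)) p = 0.
Proof.
move=> pv; have n0 := inner_derive p v; rewrite pv mulr0 in n0.
pose n q := inner q q.
pose k0 := tau ^- 2 * (c 0 * d 0); pose k1 := c 1 * d 1 + c 2 * d 2.
have -> : (fun q => gmetric tau q (frame_field c q) (frame_field d q)) =
   ((k1 - k0) \*: (n : vec -> R)) + ((k0 * (1 + tau ^+ 2)) \*: (n * n)).
  apply/funext => q; rewrite gmetric_frame_field /k0 /k1 !fctE /=.
  by rewrite -[RHS]/(_ * n q + _ * (n q * n q)) /n; ring.
have h := is_deriveD (is_deriveZ (k1 - k0) n0)
   (is_deriveZ (k0 * (1 + tau ^+ 2)) (is_deriveM n0 n0)).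
by case: h => _ ->; rewrite !scaler0 !addr0 !scaler0; exact: addr0.
Qed.

End Frame.

(** * The Levi-Civita connection and its curvature *)

Section LeviCivita.
Context {R : realType} (tau : R) (tau0 : tau != 0).
Notation vec := 'rV[R]_4.
Context (nabla : (vec -> vec) -> (vec -> vec) -> vec -> vec).
Context (LC : is_levi_civita tau nabla).
Implicit Types (p q v : vec) (c d e : 'I_3 -> R).

Local Notation field := (frame_field tau).
Local Notation coord := (frame_coord tau).
Local Notation Omega := (connection_vec tau).

Lemma frame_coordD p u v i : coord p (u + v) i = coord p u i + coord p v i.
Proof. by rewrite /frame_coord /gmetric /inner !mxE; ring. Qed.

Lemma frame_coordZ p (a : R) v i : coord p (a *: v) i = a * coord p v i.
Proof. by rewrite /frame_coord /gmetric /inner !mxE; ring. Qed.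

Lemma gmetricC p u v : gmetric tau p u v = gmetric tau p v u.
Proof. by rewrite /gmetric /inner; ring. Qed.

Lemma gmetric_subl p u v w :
  gmetric tau p (u - v) w = gmetric tau p u w - gmetric tau p v w.
Proof. by rewrite /gmetric /inner !mxE; ring. Qed.

(** Koszul's formula.  The inner products of fields with constant coefficients are
    constant, so that only the terms with brackets remain. *)
Lemma nabla_frame_coord c d p : SL2 p ->
  coord p (nabla (field c) (field d) p) =1 cross (Omega c) d.
Proof.
move=> Sp k.
have F x := frame_field_vector_field tau x.
have skew x y z : gmetric tau p (nabla (field x) (field y) p) (field z p) =
    - gmetric tau p (nabla (field x) (field z) p) (field y p).
  have := lc_metric LC (F x) (F y) (F z) Sp.
  rewrite gmetric_frame_field_derive //; last exact: frame_field_tangent.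
  by rewrite [gmetric _ _ (field y p) _]gmetricC; lra.
have tors x y z : gmetric tau p (nabla (field x) (field y) p) (field z p) =
    gmetric tau p (nabla (field y) (field x) p) (field z p)
    + dot (structure_const tau x y) z.
  have := lc_torsion_free LC (F x) (F y) Sp.
  rewrite lie_bracket_frame_field // => h.
  rewrite -(gmetric_frame_field_SL2 tau0 _ _ Sp) -h gmetric_subl; ring.
rewrite /frame_coord E_frame_field; set e := fun i => _.
have s1 := skew c d e; have s2 := skew d e c; have s3 := skew e c d.
have t1 := tors c d e; have t2 := tors d e c; have t3 := tors e c d.
have -> : gmetric tau p (nabla (field c) (field d) p) (field e p) = 2^-1 *
   (dot (structure_const tau c d) e - dot (structure_const tau d e) c
    + dot (structure_const tau e c) d) by lra.
transitivity (dot (cross (Omega c) d) e).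
  by rewrite /dot /structure_const !axialE !crossE /connection_vec !axialE; field.
rewrite /e {s1 s2 s3 t1 t2 t3 e}.
by elim/ord3_ind: k; rewrite /dot /= ?mulr1 ?mulr0; ring.
Qed.

Lemma nabla_frame_field c d p : SL2 p ->
  nabla (field c) (field d) p = field (cross (Omega c) d) p.
Proof.
move=> Sp; have [_ tan] := conn_field (lc_connection LC)
  (frame_field_vector_field tau c) (frame_field_vector_field tau d).
rewrite -(frame_fieldK tau0 Sp (tan p Sp)).
by congr (frame_field tau _ p); apply/funext; exact: nabla_frame_coord.
Qed.

(** [nabla (field d) (field e)] has constant coefficients only on the
    hyperquadric, whence the extension axiom of connections. *)
Lemma nabla2_frame_field c d e p : SL2 p ->
  nabla (field c) (nabla (field d) (field e)) p
  = field (cross (Omega c) (cross (Omega d) e)) p.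
Proof.
move=> Sp; rewrite -nabla_frame_field //.
have F x := frame_field_vector_field tau x; have C := lc_connection LC.
apply: (conn_ext C) => //; first exact: (conn_field C).
  by move=> q; rewrite inE => Sq; exact: nabla_frame_field.
by rewrite inE.
Qed.

Lemma curvature_frame_field c d e p : SL2 p ->
  curvature nabla (field c) (field d) (field e) p =
  field (cross (axial (3 * tau ^+ 2 + 4) (- tau ^+ 2) (cross c d)) e) p.
Proof.
move=> Sp; rewrite /curvature !nabla2_frame_field // lie_bracket_frame_field //.
rewrite nabla_frame_field // -!frame_fieldN -!frame_fieldD.
congr (frame_field tau _ p); apply/funext; elim/ord3_ind.
all: rewrite !crossE /connection_vec /structure_const !axialE !crossE.
all: by field.
Qed.

Lemma nabla_frameE p u j : SL2 p ->
  nabla_frame tau nabla p u j =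
  field (cross (Omega (coord p u)) (fun i => (i == j)%:R)) p.
Proof.
move=> Sp; rewrite /nabla_frame sum3E !E_frame_field !nabla_frame_field //.
rewrite -!frame_fieldZ -!frame_fieldD; congr (frame_field tau _ p); apply/funext.
rewrite -!E_frame_field.
elim/ord3_ind; rewrite !crossE /connection_vec !axialE /frame_coord /=; ring.
Qed.

Lemma covariant_derivativeE (gamma V : R -> vec) (t : R) : SL2 (gamma t) ->
  covariant_derivative tau nabla gamma V t =
  field (fun i => derive1 (fun s => coord (gamma s) (V s) i) t +
     cross (Omega (coord (gamma t) (derive1 gamma t))) (coord (gamma t) (V t)) i)
    (gamma t).
Proof.
move=> Sp; rewrite /covariant_derivative sum3E !nabla_frameE //.
rewrite !E_frame_field -!frame_fieldZ -!frame_fieldD.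
congr (frame_field tau _ _); apply/funext; rewrite -!E_frame_field.
elim/ord3_ind; rewrite !crossE /frame_coord /=; ring.
Qed.

Lemma curvature_atE p u v w : SL2 p ->
  curvature_at tau nabla p u v w =
  field (cross (axial (3 * tau ^+ 2 + 4) (- tau ^+ 2)
    (cross (coord p u) (coord p v))) (coord p w)) p.
Proof. by move=> Sp; rewrite -curvature_frame_field. Qed.

End LeviCivita.

(** * Curves in the frame *)

Section DifferentiabilityClass.
Context {R : realType} (I : set R).

(** [n]-fold differentiability, with the derivative as a witness that is
    constrained on [I] only: this makes the class stable under products without
    any extensionality off [I]. *)
Fixpoint diff_on (n : nat) (f : R -> R) : Prop :=
  if n is m.+1 then
    exists2 g, (forall t, I t -> is_derive t 1 f (g t)) & diff_on m g
  else True.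

Lemma diff_on_ext n f g : (forall s, f s = g s) -> diff_on n g -> diff_on n f.
Proof. by move=> /funext ->. Qed.

Lemma diff_onW n f : diff_on n.+1 f -> diff_on n f.
Proof. by elim: n f => [//|n ih] f [g fg /ih gn]; exists g. Qed.

Lemma diff_on_add n f g :
  diff_on n f -> diff_on n g -> diff_on n (fun s => f s + g s).
Proof.
elim: n f g => [//|n ih] f g [f' ff' f'n] [g' gg' g'n].
exists (fun s => f' s + g' s); last exact: ih.
by move=> t It; apply: is_derive_add; [exact: ff'|exact: gg'].
Qed.

Lemma diff_on_opp n f : diff_on n f -> diff_on n (fun s => - f s).
Proof.
elim: n f => [//|n ih] f [f' ff' f'n].
exists (fun s => - f' s); last exact: ih.
by move=> t It; apply: is_derive_opp; exact: ff'.
Qed.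

Lemma diff_on_mul n f g :
  diff_on n f -> diff_on n g -> diff_on n (fun s => f s * g s).
Proof.
elim: n f g => [//|n ih] f g fn gn.
case: (fn) => f' ff' f'n; case: (gn) => g' gg' g'n.
exists (fun s => f s * g' s + g s * f' s).
  by move=> t It; apply: is_derive_mul; [exact: ff'|exact: gg'].
by apply: diff_on_add; apply: ih => //; exact: diff_onW.
Qed.

Lemma diff_on_const n c : diff_on n (fun=> c).
Proof.
elim: n c => [//|n ih] c; exists (fun=> 0) => // t _; exact: is_derive_const.
Qed.

Lemma diff_on_derive1 n f : open I -> diff_on n.+1 f -> diff_on n (derive1 f).
Proof.
move=> Io [g fg gn].
have eg t : I t -> g t = derive1 f t by move=> /fg [_ <-]; rewrite derive1E.
case: n gn => [//|n] [h gh hn]; exists h => // t It.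
exact: is_derive_open Io It eg (gh t It).
Qed.

Lemma diff_on_is_derive n f t :
  diff_on n.+1 f -> I t -> is_derive t 1 f (derive1 f t).
Proof. by move=> [g fg _] /fg ft; rewrite derive1E; case: (ft) => _ ->. Qed.

End DifferentiabilityClass.

Section CovariantAlongCurve.
Context {R : realType} (I : set R) (Iopen : open I).
Implicit Types omega u v : R -> 'I_3 -> R.

Definition cov_deriv omega u t i : R :=
  derive1 (fun s => u s i) t + cross (omega t) (u t) i.

Lemma cov_derivP omega u : (forall i, diff_on I 1 (fun s => u s i)) ->
  has_cov_deriv I omega u (cov_deriv omega u).
Proof.
move=> ud t It i; rewrite /cov_deriv addrK; exact: diff_on_is_derive (ud i) It.
Qed.

Lemma has_cov_deriv_unique omega u Du t i : has_cov_deriv I omega u Du -> I t ->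
  cov_deriv omega u t i = Du t i.
Proof.
by move=> /(_ t) uD /uD /(_ i) [_ ui]; rewrite /cov_deriv derive1E ui subrK.
Qed.

Lemma cross_diff_on n u v i :
  (forall j, diff_on I n (fun s => u s j)) ->
  (forall j, diff_on I n (fun s => v s j)) ->
  diff_on I n (fun s => cross (u s) (v s) i).
Proof.
move=> un vn; elim/ord3_ind: i; apply: diff_on_add; do ?apply: diff_on_opp;
  exact: diff_on_mul.
Qed.

Lemma cov_deriv_diff_on n omega u : (forall i, diff_on I n (fun s => omega s i)) ->
  (forall i, diff_on I n.+1 (fun s => u s i)) ->
  forall i, diff_on I n (fun s => cov_deriv omega u s i).
Proof.
move=> on un i; apply: diff_on_add; first exact: diff_on_derive1.
by apply: cross_diff_on => // j; exact: diff_onW.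
Qed.

Lemma eq_derive1_on (f g : R -> R) t : I t -> (forall s, I s -> f s = g s) ->
  derive1 f t = derive1 g t.
Proof.
move=> It fg; rewrite !derive1E; apply: near_eq_derive; near=> s; apply: fg; near: s.
exact: open_nbhs_nbhs.
Unshelve. all: end_near. Qed.

Lemma eq_cov_deriv omega u v t : I t -> (forall s, I s -> u s = v s) ->
  cov_deriv omega u t = cov_deriv omega v t.
Proof.
move=> It uv; apply/funext => i; rewrite /cov_deriv uv //; congr (_ + _).
by apply: eq_derive1_on => // s /uv ->.
Qed.

End CovariantAlongCurve.

Lemma ord4_ind (P : 'I_4 -> Prop) : P 0 -> P 1 -> P 2 -> P 3 -> forall i, P i.
Proof.
by move=> P0 P1 P2 P3 [[|[|[|[|//]]]] i4]; [move: P0|move: P1|move: P2|move: P3];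
  congr P; exact: val_inj.
Qed.

Section CurveInFrame.
Context {R : realType} (tau : R) (tau0 : tau != 0).
Notation vec := 'rV[R]_4.
Context (I : set R) (Iopen : open I) (gamma : R -> vec) (gsm : smooth_curve I gamma).

Lemma curve_coord_is_derive n t k : I t -> is_derive t 1
  (fun s => derive1n n gamma s 0 k) (derive1n n.+1 gamma t 0 k).
Proof.
move=> It; have [/(_ n t It) dg _] := gsm.
apply: DeriveDef; first by have /derivable_mxP := dg; exact.
by rewrite derive1nS /= derive1E derive_mx // mxE.
Qed.

Lemma curve_coord_diff_on m n k : diff_on I m (fun s => derive1n n gamma s 0 k).
Proof.
elim: m n => [//|m ih] n; exists (fun s => derive1n n.+1 gamma s 0 k) => // t.
exact: curve_coord_is_derive.
Qed.

Lemma velocity_tangent t : I t -> tangent (gamma t) (derive1 gamma t).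
Proof.
move=> It; have [_ gS] := gsm.
have c k := curve_coord_is_derive 0 k It.
pose m k := is_derive_mul (c k) (c k).
have h := is_derive_add (is_derive_add (is_derive_add (m 0) (m 1))
  (is_derive_opp (m 2))) (is_derive_opp (m 3)).
have := derive_locally_const Iopen It gS h.
rewrite /tangent /inner /=; lra.
Qed.

Lemma velocity_coord_diff_on n i :
  diff_on I n (fun s => frame_coord tau (gamma s) (derive1 gamma s) i).
Proof.
have g0 k : diff_on I n (fun s => gamma s 0 k) := curve_coord_diff_on n 0 k.
have g1 k : diff_on I n (fun s => derive1 gamma s 0 k) := curve_coord_diff_on n 1 k.
have inner_diff (a b : R -> vec) : (forall k, diff_on I n (fun s => a s 0 k)) ->
    (forall k, diff_on I n (fun s => b s 0 k)) ->
    diff_on I n (fun s => inner (a s) (b s)).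
  by move=> ha hb; do ?apply: diff_on_add; do ?apply: diff_on_opp;
    exact: diff_on_mul.
have X1d k : diff_on I n (fun s => X1 (gamma s) 0 k).
  have e s := X1E (gamma s).
  elim/ord4_ind: k.
  - by apply: (diff_on_ext (fun s => (e s).1.1.1)); exact: diff_on_opp.
  - by apply: (diff_on_ext (fun s => (e s).1.1.2)).
  - by apply: (diff_on_ext (fun s => (e s).1.2)); exact: diff_on_opp.
  - by apply: (diff_on_ext (fun s => (e s).2)).
have Ed k : diff_on I n (fun s => E tau i (gamma s) 0 k).
  rewrite E_frame_field; pose c (j : 'I_3) : R := (j == i)%:R.
  have e s := frame_fieldE tau c (gamma s).
  have cst_mul (x : R) l : diff_on I n (fun s => x * gamma s 0 l).
    by apply: diff_on_mul; [exact: diff_on_const|exact: g0].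
  elim/ord4_ind: k.
  - by apply: (diff_on_ext (fun s => (e s).1.1.1)); do ?apply: diff_on_add.
  - apply: (diff_on_ext (fun s => (e s).1.1.2)).
    by do ?apply: diff_on_add => //; exact: diff_on_opp.
  - by apply: (diff_on_ext (fun s => (e s).1.2)); do ?apply: diff_on_add.
  - apply: (diff_on_ext (fun s => (e s).2)).
    by do ?apply: diff_on_add => //; exact: diff_on_opp.
apply: diff_on_add; first by apply: diff_on_opp; exact: inner_diff.
do ?apply: diff_on_mul; first exact: diff_on_const.
all: exact: inner_diff.
Qed.

End CurveInFrame.

(** * Biharmonic curves and their Frenet frame *)

Section BiharmonicCurve.
Context {R : realType} (tau : R) (tau0 : tau != 0).
Notation vec := 'rV[R]_4.
Context (nabla : (vec -> vec) -> (vec -> vec) -> vec -> vec).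
Context (LC : is_levi_civita tau nabla) (I : set R) (Iopen : open I).
Context (gamma : R -> vec) (gsm : smooth_curve I gamma).

Let gS t : I t -> SL2 (gamma t). Proof. by case: gsm => _; exact. Qed.

Definition velocity_coord t := frame_coord tau (gamma t) (derive1 gamma t).
Definition angular_velocity t := connection_vec tau (velocity_coord t).
Definition accel_coord := cov_deriv angular_velocity velocity_coord.
Definition jerk_coord := cov_deriv angular_velocity accel_coord.

Let T := velocity_coord.
Let omega := angular_velocity.
Let A := accel_coord.
Let D := jerk_coord.

Let T_diff n i : diff_on I n (fun s => T s i).
Proof. exact: velocity_coord_diff_on. Qed.

Let omega_diff n i : diff_on I n (fun s => omega s i).
Proof.
by elim/ord3_ind: i; apply: diff_on_mul; by [exact: diff_on_const|exact: T_diff].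
Qed.

Let A_diff n i : diff_on I n (fun s => A s i).
Proof. exact: cov_deriv_diff_on. Qed.

Let D_diff n i : diff_on I n (fun s => D s i).
Proof. exact: cov_deriv_diff_on. Qed.

Lemma velocity_has_cov_deriv : has_cov_deriv I omega T A.
Proof. exact: cov_derivP. Qed.

Lemma accel_has_cov_deriv : has_cov_deriv I omega A D.
Proof. exact: cov_derivP. Qed.

Lemma jerk_has_cov_deriv : has_cov_deriv I omega D (cov_deriv omega D).
Proof. exact: cov_derivP. Qed.

Lemma covariant_derivative_frame V v t : I t ->
  (forall s, I s -> frame_coord tau (gamma s) (V s) = v s) ->
  covariant_derivative tau nabla gamma V t =
  frame_field tau (cov_deriv omega v t) (gamma t).
Proof.
move=> It Vv; rewrite -(eq_cov_deriv Iopen omega It Vv).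
by rewrite (covariant_derivativeE tau0 LC) //; exact: gS.
Qed.

Lemma frame_coord_covariant_derivative V v t : I t ->
  (forall s, I s -> frame_coord tau (gamma s) (V s) = v s) ->
  frame_coord tau (gamma t) (covariant_derivative tau nabla gamma V t) =
  cov_deriv omega v t.
Proof.
move=> It Vv; apply/funext => i; rewrite (covariant_derivative_frame It Vv).
exact: (frame_coordK tau0 _ (gS It)).
Qed.

Lemma acceleration_frame t : I t ->
  acceleration tau nabla gamma t = frame_field tau (A t) (gamma t).
Proof. by move=> It; exact: covariant_derivative_frame. Qed.

Lemma gmetric_acceleration t : I t ->
  gmetric tau (gamma t) (acceleration tau nabla gamma t)
    (acceleration tau nabla gamma t) = dot (A t) (A t).
Proof.
move=> It; rewrite acceleration_frame // gmetric_frame_field_SL2 //; exact: gS.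
Qed.

Lemma biharmonic_ode : biharmonic tau nabla I gamma ->
  forall t, I t -> forall i, cov_deriv omega D t i =
    cross (axial (3 * tau ^+ 2 + 4) (- tau ^+ 2) (cross (T t) (A t))) (T t) i.
Proof.
move=> bih t It i; have /eqP := bih t It; rewrite subr_eq0 => /eqP /= bihE.
have coordA s : I s -> frame_coord tau (gamma s)
    (covariant_derivative tau nabla gamma (derive1 gamma) s) = A s.
  by move=> Is; exact: frame_coord_covariant_derivative.
have coordD s : I s -> frame_coord tau (gamma s)
    (covariant_derivative tau nabla gamma
      (covariant_derivative tau nabla gamma (derive1 gamma)) s) = D s.
  by move=> Is; exact: frame_coord_covariant_derivative.
have St := gS It.
rewrite -(frame_coord_covariant_derivative It coordD) bihE.
by rewrite (curvature_atE tau0 LC) // (frame_coordK tau0) // coordA.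
Qed.

Lemma velocity_coord_unit t : arc_length_param tau I gamma -> I t ->
  dot (T t) (T t) = 1.
Proof.
move=> arc It; have Tt := velocity_tangent Iopen gsm It; have St := gS It.
by rewrite -(arc t It) (gmetric_dot tau0).
Qed.

(** Since [k1] is constant, the unit normal [N = A / k1] has [D N = D / k1], and
    [k2 = <D N, T x N>] becomes a triple product. *)
Lemma frenet_torsion (f : R) (N B : R -> vec) (k1 k2 : R -> R) :
  arc_length_param tau I gamma -> frenet_apparatus tau nabla I gamma N B k1 k2 ->
  0 < f -> (forall t, I t -> dot (A t) (A t) = f) ->
  forall t, I t -> k2 t = dot (cross (T t) (A t)) (D t) / f.
Proof.
move=> arc frenet f_gt0 AA t It.
have sf0 : Num.sqrt f != 0 by rewrite sqrtr_eq0 -ltNge.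
have acc_neq0 s : I s -> acceleration tau nabla gamma s <> 0.
  move=> Is acc0; have := gmetric_acceleration Is.
  rewrite acc0 AA // /gmetric /inner !mxE => e; move: f_gt0; lra.
pose n s i := (Num.sqrt f)^-1 * A s i.
have coordN s : I s -> frame_coord tau (gamma s) (N s) = n s.
  move=> Is; have [k1s /(_ (acc_neq0 s Is)) [_ accN _ _]] := frenet s Is.
  rewrite gmetric_acceleration // AA // in k1s.
  have -> : N s = (Num.sqrt f)^-1 *: acceleration tau nabla gamma s.
    by rewrite [acceleration _ _ _ _]accN k1s scalerA mulVf // scale1r.
  apply/funext => i; rewrite frame_coordZ acceleration_frame //.
  by rewrite (frame_coordK tau0) //; exact: gS.
have n_cov : has_cov_deriv I omega n (fun s i => (Num.sqrt f)^-1 * D s i).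
  move=> s Is i.
  apply: (is_derive_eq (is_derive_mul (is_derive_const _ s)
    (accel_has_cov_deriv Is i))).
  by elim/ord3_ind: i; rewrite /n !crossE; ring.
have [_ /(_ (acc_neq0 t It)) [[tan on det_gt0] _ dN _]] := frenet t It.
pose b := frame_coord tau (gamma t) (B t).
have onE i j := gmetric_dot tau0 (gS It) (tan i) (tan j).
have nn : dot (n t) (n t) = 1.
  by rewrite -(coordN t It) -(onE 1 1); exact: (on 1 1).
have bb : dot b b = 1 by rewrite -(onE 2 2); exact: (on 2 2).
have Tn : dot (T t) (n t) = 0.
  by rewrite -(coordN t It) -(onE 0 1); exact: (on 0 1).
have Tb : dot (T t) b = 0 by rewrite -(onE 0 2); exact: (on 0 2).
have nb : dot (n t) b = 0.
  by rewrite -(coordN t It) -(onE 1 2); exact: (on 1 2).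
have bE i : b i = cross (T t) (n t) i.
  apply: oriented_orthonormal_cross => //; first exact: velocity_coord_unit.
  move: det_gt0; rewrite det3_dot_cross /dot !crossE !mxE /=.
  by rewrite -(coordN t It).
have Dn i : (Num.sqrt f)^-1 * D t i = - k1 t * T t i + k2 t * b i.
  rewrite -(has_cov_deriv_unique i n_cov It).
  rewrite -(frame_coord_covariant_derivative It coordN) dN.
  by rewrite frame_coordD !frame_coordZ.
have <- : dot b (fun i => (Num.sqrt f)^-1 * D t i) = k2 t.
  transitivity (- k1 t * dot (T t) b + k2 t * dot b b).
    by rewrite {1}/dot !Dn /dot; ring.
  by rewrite Tb bb; ring.
transitivity ((Num.sqrt f)^-1 ^+ 2 * dot (cross (T t) (A t)) (D t)).
  by rewrite /dot !bE !crossE /n; ring.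
by rewrite exprVn sqr_sqrtr 1?ltW // mulrC.
Qed.

End BiharmonicCurve.

Theorem proposition3p2 (R : realType) (tau : R) (htau : 0 < tau)
  (nabla : ('rV[R]_4 -> 'rV[R]_4) -> ('rV[R]_4 -> 'rV[R]_4) -> 'rV[R]_4 -> 'rV[R]_4)
  (hnabla : is_levi_civita tau nabla)
  (I : set R) (hIopen : open I) (hIitv : is_interval I)
  (gamma : R -> 'rV[R]_4) (hgamma : smooth_curve I gamma)
  (harc : arc_length_param tau I gamma)
  (hbih : proper_biharmonic tau nabla I gamma)
  (N B : R -> 'rV[R]_4) (k1 k2 : R -> R)
  (hfrenet : frenet_apparatus tau nabla I gamma N B k1 k2) :
  (exists c : R, forall t, I t -> k1 t = c) /\
  (exists c : R, forall t, I t -> k2 t = c).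
Proof.
have tau0 : tau != 0 by exact: lt0r_neq0.
have [bih not_geodesic] := hbih.
have covT := velocity_has_cov_deriv tau hgamma.
have covA := accel_has_cov_deriv tau hIopen hgamma.
have covD := jerk_has_cov_deriv tau hIopen hgamma.
have ode := biharmonic_ode tau0 hnabla hIopen hgamma bih.
have TT t (It : I t) := velocity_coord_unit tau0 hIopen hgamma harc It.
have [f AA] := curvature_const hIopen hIitv covT covA covD ode TT.
have f_gt0 : 0 < f.
  have [//|f_le0] := ltP 0 f; case: not_geodesic => t It.
  rewrite (acceleration_frame tau0 hnabla hIopen hgamma It).
  have A0 : accel_coord tau gamma t =1 fun=> 0.
    apply: dot_eq0; apply/eqP; rewrite eq_le dot_ge0 andbT.
    by apply: le_trans f_le0; rewrite AA.
  by rewrite /frame_field big1 // => i _; rewrite A0 scale0r.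
have [q qE] := torsion_const hIopen hIitv covT covA covD ode TT f_gt0 AA.
split.
  exists (Num.sqrt f) => t It; have [-> _] := hfrenet t It.
  by rewrite (gmetric_acceleration tau0 hnabla hIopen hgamma It) AA.
exists (q / f) => t It.
rewrite (frenet_torsion tau0 hnabla hIopen hgamma harc hfrenet f_gt0 AA It).
by rewrite qE.
Qed.
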